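(* Let $\eta=\frac{1-\kappa}{1-\theta}$. (1) If $\eta\ge1$, the first-best equilibrium necessarily consists of both NV and SAV commuters (case (i) arises). Moreover, the first-best policy minimizes the social cost without increasing the individual commuting cost: if $(AN-B)^2-4AF_a\ge0$, then $$c_1^{FB*}\le c^{MC*}<c_2^{AC*}\le c^{m*}<c_0^{AC*},$$ where $c_1^{FB*}$ is the first-best equilibrium commuting cost in case (i). Therefore, a Pareto improvement is achieved from the equilibrium that arises under any of the fare-setting scenarios (marginal cost, average cost, unregulated monopoly). (2) If $\eta<1$, the first-best policy minimizes the social cost, but it increases the commuting costs at least relative to the equilibrium under marginal cost pricing: $c^{FB*}>c^{MC*}$.
   Context: Model. A continuum of commuters of mass $N>0$ uses normal vehicles (NV, mass $N_n$) or shared autonomous vehicles (SAV, mass $N_a$), $N_n+N_a=N$, through a bottleneck of capacity $\mu>0$. Parameters: free-flow time $t_f\ge 0$; NV fixed cost $F_n\ge 0$; SAV waiting cost $w\ge 0$; SAV marginal operating cost $m\ge 0$; SAV fixed operating cost $F_a>0$; $\beta,\gamma>0$; $\theta$ with $\beta<\theta<1$; $0<\kappa<1$. Schedule cost: $s(t)=-\beta t$ for $t<0$, $s(t)=\gamma t$ for $t\ge0$. Set $A=\frac{\beta\gamma(1-\theta)}{(\beta+\gamma)\mu}$, $B=\theta t_f+m+w-(t_f+F_n)$. Standing assumption: $0<B<AN$. First-best optimum: the problem of minimizing $$SC=\int_{\mathbb R}\big[n_n(t)(t_f+s(t)+F_n)+n_a(t)(\theta t_f+s(t)+m+w)\big]dt+F_a$$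 over $n_n,n_a\ge0$ with $\int_{\mathbb R}(n_n+n_a)dt=N$ and $n_n(t)+\kappa n_a(t)\le\mu$ for all $t$. First-best policy: SAV fare $p=m$ plus a time-varying toll $\tau(t)\ge0$ for NV commuters and $\kappa\tau(t)$ for SAV commuters arriving at time $t$. A first-best equilibrium is $(n_n,n_a,\tau,c^{FB*})$, with $n_n,n_a,\tau\ge0$, such that for all $t$: $s(t)+t_f+F_n+\tau(t)\ge c^{FB*}$ with equality if $n_n(t)>0$; $s(t)+\theta t_f+m+w+\kappa\tau(t)\ge c^{FB*}$ with equality if $n_a(t)>0$; $n_n(t)+\kappa n_a(t)\le\mu$ with equality if $\tau(t)>0$; and $\int_{\mathbb R}(n_n+n_a)dt=N$. Case (i) means both vehicle types are used with positive mass; case (ii) means only NVs are used. $c^{FB*}$ is the first-best equilibrium commuting cost (toll included). ''The first-best policy minimizes the social cost'' means that the first-best equilibrium flows $(n_n,n_a)$ minimize $SC=\int_{\mathbb R}\big[n_n(t)(t_f+s(t)+F_n)+n_a(t)(\theta t_f+s(t)+m+w)\big]dt+F_a$ over all $n_n,n_a\ge0$ with $\int_{\mathbb R}(n_n+n_a)dt=N$ and $n_n(t)+\kappa n_a(t)\le\mu$ for all $t$. Toll-free scenarios. For a split and fare $p$, the commuting costs are $c_n^*=\frac{\beta\gamma}{\mu(\beta+\gamma)}(N_n+\kappa N_a)+t_f+F_n$ and $c_a^*=\frac{\beta\gamma}{\mu(\beta+\gamma)}(\theta N_n+\kappa N_a)+\theta t_f+p+w$; in equilibrium the used modes have equal cost,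 the equilibrium commuting cost. The equilibria are: marginal cost (MC) pricing $p=m$, with $N_a^{MC*}=\frac{AN-B}{A}$ and cost $c^{MC*}$; average cost (AC) pricing $p=m+F_a/N_a$, with $N_{a0}^{AC*}=0$ (all commuters NV, cost $c_0^{AC*}$) and, when $(AN-B)^2\ge4AF_a$, the high-adoption equilibrium $N_{a2}^{AC*}=\frac{AN-B+\sqrt{(AN-B)^2-4AF_a}}{2A}$ with cost $c_2^{AC*}$; unregulated monopoly pricing $p=m+\frac{AN-B}{2}$, with $N_a^{m*}=\frac{AN-B}{2A}$ and cost $c^{m*}$ when $(AN-B)^2\ge4AF_a$. The social cost of a toll-free equilibrium is total commuting cost $N_nc_n^*+N_ac_a^*$ (only the used mode counted when one mode is unused) minus provider profit $\pi=(p-m)N_a-F_a$ (with $\pi=-F_a$ if $N_a=0$). A Pareto improvement means that the social cost is reduced without increasing any commuter's cost. *)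

(* Defs.v *)
From HB Require Import structures.
From mathcomp Require Import all_boot all_order all_algebra.
From mathcomp Require Import all_classical all_reals all_analysis.
From mathcomp Require Import ring lra.

Set Implicit Arguments.
Unset Strict Implicit.
Unset Printing Implicit Defensive.
Import Order.TTheory GRing.Theory Num.Theory.
Import numFieldNormedType.Exports.
Local Open Scope classical_set_scope.
Local Open Scope ring_scope.

Record params (R : realType) := Params {
  mass : R;          (* N *)
  capacity : R;      (* mu *)
  t_free : R;        (* t_f *)
  nv_fixed : R;      (* F_n *)
  sav_wait : R;      (* w *)
  sav_marginal : R;  (* m *)
  sav_fixed : R;     (* F_a *)
  beta : R;
  gamma : R;
  theta : R;
  kappa : R
}.

Section Model.
Context {R : realType}.
Variable P : params R.
Implicit Types (t c : R) (n_n n_a tau : R -> R).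

Local Notation N := (mass P).
Local Notation mu := (capacity P).
Local Notation t_f := (t_free P).
Local Notation F_n := (nv_fixed P).
Local Notation w := (sav_wait P).
Local Notation m := (sav_marginal P).
Local Notation F_a := (sav_fixed P).
Local Notation b := (beta P).
Local Notation g := (gamma P).
Local Notation th := (theta P).
Local Notation k := (kappa P).

Definition A : R := b * g * (1 - th) / ((b + g) * mu).

Definition B : R := th * t_f + m + w - (t_f + F_n).

Definition eta_ratio : R := (1 - k) / (1 - th).

Definition standing : Prop :=
  [/\ [/\ 0 < N, 0 < mu & 0 <= t_f],
      [/\ 0 <= F_n, 0 <= w, 0 <= m & 0 < F_a],
      [/\ 0 < b, 0 < g, b < th & th < 1],
      0 < k < 1
    & 0 < B < A * N].

Definition schedule_cost t : R := if t < 0 then - b * t else g * t.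

Definition nv_trip_cost t : R := t_f + schedule_cost t + F_n.

(* m enters both as the resource cost in SC and as the first-best fare. *)
Definition sav_trip_cost t : R := th * t_f + schedule_cost t + m + w.

Definition feasible n_n n_a : Prop :=
  [/\ measurable_fun setT n_n /\ measurable_fun setT n_a,
      forall t, 0 <= n_n t /\ 0 <= n_a t,
      (\int[lebesgue_measure]_t (n_n t + n_a t)%:E = N%:E)%E
    & forall t, n_n t + k * n_a t <= mu].

(* On feasible flows the integrand is nonnegative, so that the integral is
   always meaningful, possibly with value +oo. *)
Definition social_cost n_n n_a : \bar R :=
  ((\int[lebesgue_measure]_t
      (n_n t * nv_trip_cost t + n_a t * sav_trip_cost t)%:E) + F_a%:E)%E.

Definition minimizes_social_cost n_n n_a : Prop :=
  feasible n_n n_a /\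
  forall n_n' n_a', feasible n_n' n_a' ->
    (social_cost n_n n_a <= social_cost n_n' n_a')%E.

Definition first_best_equilibrium n_n n_a tau c : Prop :=
  [/\ feasible n_n n_a,
      forall t, 0 <= tau t,
      forall t, c <= nv_trip_cost t + tau t /\
                (0 < n_n t -> nv_trip_cost t + tau t = c),
      forall t, c <= sav_trip_cost t + k * tau t /\
                (0 < n_a t -> sav_trip_cost t + k * tau t = c)
    & forall t, 0 < tau t -> n_n t + k * n_a t = mu].

Definition both_modes_used n_n n_a : Prop :=
  (0 < \int[lebesgue_measure]_t (n_n t)%:E)%E /\
  (0 < \int[lebesgue_measure]_t (n_a t)%:E)%E.

(* A toll-free outcome is a fare p with an SAV mass N_a; N_n is N - N_a. *)
Record outcome := Outcome { fare : R; savs : R }.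
Implicit Type e : outcome.

Definition nvs e : R := N - savs e.

Definition nv_cost e : R :=
  b * g / (mu * (b + g)) * (nvs e + k * savs e) + t_f + F_n.

Definition sav_cost e : R :=
  b * g / (mu * (b + g)) * (th * nvs e + k * savs e) + th * t_f + fare e + w.

Definition tollfree_equilibrium e c : Prop :=
  [/\ 0 <= nvs e, 0 <= savs e,
      0 < nvs e -> nv_cost e = c
    & 0 < savs e -> sav_cost e = c].

Definition profit e : R := (fare e - m) * savs e - F_a.

Definition tollfree_social_cost e : R :=
  nvs e * nv_cost e + savs e * sav_cost e - profit e.

Definition discriminant : R := (A * N - B) ^+ 2 - 4 * A * F_a.

Definition average_cost_fare (N_a : R) : R := m + F_a / N_a.

Definition MC : outcome := Outcome m ((A * N - B) / A).

(* The average cost fare is infinite at N_a = 0; the value used here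
   (F_a / 0 = 0) is immaterial, as the fare is always weighted by N_a. *)
Definition AC0 : outcome := Outcome (average_cost_fare 0) 0.

Definition AC2 : outcome :=
  let N_a := (A * N - B + Num.sqrt discriminant) / (2 * A) in
  Outcome (average_cost_fare N_a) N_a.

Definition monopoly : outcome :=
  Outcome (m + (A * N - B) / 2) ((A * N - B) / (2 * A)).

(* NVs are used in all four outcomes, so the common cost of the used modes is
   the NV cost; see the lemmas tollfree_MC, ..., tollfree_monopoly below. *)
Definition c_MC : R := nv_cost MC.
Definition c_AC0 : R := nv_cost AC0.
Definition c_AC2 : R := nv_cost AC2.
Definition c_monopoly : R := nv_cost monopoly.

(* In the first-best equilibrium every commuter bears the cost c. *)
Definition pareto_improves n_n n_a c e : Prop :=
  [/\ (social_cost n_n n_a < (tollfree_social_cost e)%:E)%E,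
      0 < nvs e -> c <= nv_cost e
    & 0 < savs e -> c <= sav_cost e].

Lemma A_gt0 : standing -> 0 < A.
Proof.
case=> -[_ mu0 _] _ [b0 g0 _ th1] _ _.
by apply: divr_gt0; do ?apply: mulr_gt0; rewrite ?subr_gt0 ?addr_gt0.
Qed.

Lemma cost_gap e : standing ->
  nv_cost e - sav_cost e = A * nvs e - B - (fare e - m).
Proof.
case=> -[_ mu0 _] _ [b0 g0 _ _] _ _.
have bg0 : b + g != 0 by rewrite gt_eqF ?addr_gt0.
by rewrite /nv_cost /sav_cost /A /B; field; rewrite bg0 gt_eqF.
Qed.

Lemma tollfree_MC : standing -> 0 < nvs MC /\ tollfree_equilibrium MC c_MC.
Proof.
move=> h; have A0 := A_gt0 h; case: (h) => _ _ _ _ /andP[B0 BAN].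
have nE : nvs MC = B / A by rewrite /nvs /=; field; rewrite gt_eqF.
have n0 : 0 < nvs MC by rewrite nE divr_gt0.
split=> //; split=> //; first exact: ltW.
  by rewrite /=; apply: divr_ge0; rewrite ?subr_ge0 ltW.
move=> _; apply/esym/eqP; rewrite -subr_eq0 cost_gap// nE /=.
by apply/eqP; field; rewrite gt_eqF.
Qed.

Lemma tollfree_AC0 : standing -> 0 < nvs AC0 /\ tollfree_equilibrium AC0 c_AC0.
Proof.
case=> -[N0 _ _] _ _ _ _.
have n0 : 0 < nvs AC0 by rewrite /nvs /= subr0.
by split=> //; split; rewrite /= ?ltxx// ltW.
Qed.

Lemma tollfree_AC2 : standing -> 0 <= discriminant ->
  0 < nvs AC2 /\ tollfree_equilibrium AC2 c_AC2.
Proof.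
move=> h d0; have A0 := A_gt0 h.
case: (h) => _ [_ _ _ Fa0] _ _ /andP[B0 BAN].
have A2 : 0 < 2 * A by apply: mulr_gt0.
have x0 : 0 < A * N - B by rewrite subr_gt0.
have sE := sqr_sqrtr d0; have s0 := sqrtr_ge0 discriminant.
have sx : Num.sqrt discriminant < A * N - B.
  rewrite -(@ltr_pXn2r _ 2) ?nnegrE ?s0 ?(ltW x0)// sE /discriminant.
  by rewrite ltrBlDr ltrDl mulr_gt0// mulr_gt0.
have n0 : 0 < nvs AC2.
  by rewrite /nvs /= subr_gt0 ltr_pdivrMr//; lra.
have a0 : 0 < savs AC2 by apply: divr_gt0 => //; lra.
split=> //; split=> //; try exact: ltW.
move=> _; apply/esym/eqP; rewrite -subr_eq0 cost_gap//.
rewrite /nvs /= /average_cost_fare.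
set s := Num.sqrt _ in sE s0 sx *.
have FaE : F_a = ((A * N - B) ^+ 2 - s ^+ 2) / (4 * A).
  by rewrite sE /discriminant; field; rewrite gt_eqF.
apply/eqP; rewrite FaE; field.
by rewrite !gt_eqF// ltr_wpDr.
Qed.

Lemma tollfree_monopoly : standing ->
  0 < nvs monopoly /\ tollfree_equilibrium monopoly c_monopoly.
Proof.
move=> h; have A0 := A_gt0 h; case: (h) => _ _ _ _ /andP[B0 BAN].
have A2 : 0 < 2 * A by apply: mulr_gt0.
have nE : nvs monopoly = (A * N + B) / (2 * A).
  by rewrite /nvs /=; field; rewrite gt_eqF.
have n0 : 0 < nvs monopoly.
  by rewrite nE; apply: divr_gt0 => //; lra.
split=> //; split=> //; first exact: ltW.
  by rewrite /=; apply: divr_ge0; rewrite ?subr_ge0 ltW.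
move=> _; apply/esym/eqP; rewrite -subr_eq0 cost_gap// nE /=.
by apply/eqP; field; rewrite gt_eqF.
Qed.

End Model.

(* Main.v *)
Require Import Defs.
From HB Require Import structures.
From mathcomp Require Import all_boot all_order all_algebra.
From mathcomp Require Import all_classical all_reals all_analysis.
From mathcomp Require Import measurable_realfun ring lra.

Import Order.TTheory GRing.Theory Num.Theory.
Import numFieldNormedType.Exports.
Local Open Scope classical_set_scope.
Local Open Scope ring_scope.

(** Write s for the schedule cost, alpha = t_f + F_n, C = c - alpha for the
    rent available at s = 0, and D = B / (1 - kappa). At time t an NV user is
    willing to pay C - s(t) per unit of capacity and a SAV user
    (C - s(t) - B) / kappa; the second bid exceeds the first exactly when
    C - s(t) > D. Complementary slackness therefore forces the toll to be the
    larger bid, when positive: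
      tau(t) = max(0, C - s(t)) + (1/kappa - 1) max(0, C - D - s(t)),
    and, outside the at most four times where s(t) is C or C - D, forces the
    bottleneck to be full of NVs where C - D < s < C and full of SAVs where
    s < C - D ([equilibrium_toll], [equilibrium_flows]). As the window
    {s < x} has length x / delta with delta = beta gamma / (beta + gamma),
    total mass N determines C. With K = delta / mu, either C > D and
    C = kappa N K + B, both modes being used, or C <= D and C = N K
    ([equilibrium_cost]). The same formulas define an equilibrium, whence
    existence ([first_best_equilibrium_exists]).

    Optimality is linear programming duality, with tau the multiplier of the
    capacity constraint and c that of the mass constraint: for any feasible
    flow, resource cost plus mu times the integral of tau is at least c N,
    with equality at equilibrium ([weak_duality], [strong_duality]). The
    equality also gives the first-best social cost explicitly, because the
    toll is a combination of two tents max(0, x - s), each of integral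
    x^2 / (2 delta).

    What remains is algebra. A = K (1 - theta) gives
    c_MC = alpha + kappa N K + eta B, and comparison with
    c = alpha + kappa N K + B (or alpha + N K) decides the sign of c_MC - c by
    that of eta - 1. A toll-free NV cost decreases with SAV adoption, which
    orders the three pricing schemes. Finally, with n = N - a the toll-free
    social cost at adoption a exceeds the first-best one by
      K/2 (n^2 + kappa a^2) + K theta n a + K (1 - kappa)/2 (n - D/K)^2 > 0
    ([splitting_cost_lt]): the first two terms are avoidable queueing, the last
    is the loss from a suboptimal modal split. *)

(** * Arrival windows and their integrals *)

Lemma integral_affine (R : realType) (p q x y : R) : x < y ->
  (\int[lebesgue_measure]_(t in `[x, y]) (p + q * t)%:E =
   (p * (y - x) + q * (y ^+ 2 - x ^+ 2) / 2)%:E)%E.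
Proof.
move=> xy; pose F (t : R) : R := p * t + q / 2 * t ^+ 2.
have dF t : is_derive t (1:R) F (p + q * t).
  rewrite /F; apply: is_derive_eq; rewrite /GRing.scale /=; by field.
have cF : continuous F.
  move=> z; apply: differentiable_continuous; apply/derivable1_diffP.
  exact: ex_derive.
have -> : (p * (y - x) + q * (y ^+ 2 - x ^+ 2) / 2 = F y - F x)%R.
  by rewrite /F; field.
rewrite EFinB; apply: (continuous_FTC2 (f := fun t => p + q * t)) => //.
- apply: continuous_subspaceT => z; apply: cvgD; first exact: cvg_cst.
  by apply: cvgM; [exact: cvg_cst | exact: cvg_id].
- split; [by move=> ? _; exact: ex_derive | |].
  + by apply: cvg_at_right_filter; exact: cF.
  + by apply: cvg_at_left_filter; exact: cF.
- by move=> ? _; rewrite derive1E; exact: derive_val.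
Qed.

Section Windows.
Context {R : realType} (P : params R).
Hypotheses (b0 : 0 < beta P) (g0 : 0 < gamma P).
Implicit Types x t : R.
Local Notation s := (schedule_cost P).

(** The rate at which schedule cost grows with the length of the arrival
    window: 1 / delta = 1 / beta + 1 / gamma. *)
Definition delta : R := beta P * gamma P / (beta P + gamma P).

(** The arrival times whose schedule cost is below [x]; empty if [x <= 0]. *)
Definition window x : set R := [set t | s t < x].

(** The rent left by a budget [x] after the schedule cost, or 0. *)
Definition tent x t : R := Num.max 0 (x - s t).

Lemma delta_gt0 : 0 < delta.
Proof. by rewrite divr_gt0 ?mulr_gt0 ?addr_gt0. Qed.

Lemma schedule_costE t : s t = Num.max (- beta P * t) (gamma P * t).
Proof.
have [bpos gpos] := (b0, g0); rewrite /schedule_cost; case: ltP => t0.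
  by rewrite max_l//; nra.
by rewrite max_r//; nra.
Qed.

Lemma schedule_cost_ge0 t : 0 <= s t.
Proof.
have [bpos gpos] := (b0, g0).
by rewrite /schedule_cost; case: ltP => ?; nra.
Qed.

Lemma measurable_schedule_cost : measurable_fun setT s.
Proof.
rewrite (_ : s = (fun t => Num.max (- beta P * t) (gamma P * t))).
  by apply: measurable_maxr; apply: measurable_funM => //; exact: measurable_cst.
by apply/funext => t; exact: schedule_costE.
Qed.

Lemma window_itv x : window x = `](- (x / beta P)), (x / gamma P)[%classic.
Proof.
apply/seteqP; split=> t; rewrite /window /= in_itv /= schedule_costE gt_max.
  by rewrite ltr_pdivlMr// ltrNl ltr_pdivlMr// => /andP[? ?]; apply/andP; split; lra.
by rewrite ltr_pdivlMr// ltrNl ltr_pdivlMr// => /andP[? ?]; apply/andP; split; lra.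
Qed.

Lemma measurable_window x : measurable (window x).
Proof. by rewrite window_itv. Qed.

Lemma lebesgue_measure_window x :
  lebesgue_measure (window x) = (Num.max 0 x / delta)%:E.
Proof.
rewrite window_itv lebesgue_measure_itv /= lte_fin.
have bg0 : beta P + gamma P != 0 by rewrite gt_eqF ?addr_gt0.
case: (ltP 0 x) => x0.
  have [xb xg] : 0 < x / beta P /\ 0 < x / gamma P by rewrite !divr_gt0.
  rewrite ifT; last by lra.
  by rewrite -EFinD /delta; congr EFin; field; rewrite bg0 !gt_eqF.
have [xb xg] : x / beta P <= 0 /\ x / gamma P <= 0.
  by rewrite !pmulr_lle0 ?invr_gt0.
by rewrite ifF ?mul0r//; apply/negbTE; rewrite -leNgt; lra.
Qed.

Lemma tent_ge0 x t : 0 <= tent x t.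
Proof. by rewrite /tent le_max lexx. Qed.

Lemma measurable_tent x : measurable_fun setT (tent x).
Proof.
apply: measurable_maxr; first exact: measurable_cst.
by apply: measurable_funB; [exact: measurable_cst | exact: measurable_schedule_cost].
Qed.

Lemma tent_early x t : t <= 0 -> 0 <= x + beta P * t -> tent x t = x + beta P * t.
Proof.
have [bpos gpos] := (b0, g0) => t0 xt; rewrite /tent schedule_costE.
by rewrite (max_l (_ : gamma P * t <= _)); [rewrite max_r; lra | nra].
Qed.

Lemma tent_late x t : 0 <= t -> 0 <= x - gamma P * t -> tent x t = x - gamma P * t.
Proof.
have [bpos gpos] := (b0, g0) => t0 xt; rewrite /tent schedule_costE.
by rewrite (max_r (_ : _ <= gamma P * t)); [rewrite max_r; lra | nra].
Qed.

Lemma integral_tent x : 0 < x ->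
  (\int[lebesgue_measure]_t (tent x t)%:E = (x ^+ 2 / (2 * delta))%:E)%E.
Proof.
move=> x0; set l := - (x / beta P); set r := x / gamma P.
have [bpos gpos] := (b0, g0).
have l0 : l < 0 by rewrite /l oppr_lt0 divr_gt0.
have r0 : 0 < r by rewrite /r divr_gt0.
have bl : beta P * l = - x by rewrite /l; field; rewrite gt_eqF.
have gr : gamma P * r = x by rewrite /r; field; rewrite gt_eqF.
have mt D : measurable_fun D (EFin \o tent x).
  by apply/measurable_EFinP; apply: measurable_funTS; exact: measurable_tent.
have lr : `[l, r]%classic = `[l, 0]%classic `|` `]0, r]%classic.
  by rewrite -itv_bndbnd_setU// bnd_simp ltW.
transitivity (\int[lebesgue_measure]_(t in `[l, r]) (tent x t)%:E)%E.
  rewrite [RHS]integral_mkcond; apply: eq_integral => t _.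
  rewrite patchE; case: ifPn => //; rewrite notin_setE /= in_itv /= => /negP tlr.
  have : (t < l) || (r < t) by rewrite !ltNge -negb_and.
  rewrite /tent schedule_costE => tlr'; rewrite max_l// subr_le0 le_max.
  by case/orP: tlr' => ?; apply/orP; [left|right]; nra.
rewrite lr ge0_integral_setU//=; first last.
- apply/disj_setPS => t [] /=; rewrite !in_itv /= => /andP[_ ?] /andP[? _]; lra.
- by move=> t _; rewrite lee_fin tent_ge0.
- exact: mt.
rewrite integral_itv_obnd_cbnd; last exact: mt.
have -> : (\int[lebesgue_measure]_(t in `[l, 0%R]) (tent x t)%:E =
  (x * (0 - l) + beta P * (0 ^+ 2 - l ^+ 2) / 2)%:E)%E.
  rewrite -integral_affine//; apply: eq_integral => t.
  by rewrite inE /= in_itv /= => /andP[? ?]; rewrite tent_early//; nra.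
have -> : (\int[lebesgue_measure]_(t in `[0%R, r]) (tent x t)%:E =
  (x * (r - 0) + - gamma P * (r ^+ 2 - 0 ^+ 2) / 2)%:E)%E.
  rewrite -integral_affine//; apply: eq_integral => t.
  by rewrite inE /= in_itv /= => /andP[? ?]; rewrite tent_late ?mulNr//; nra.
rewrite -EFinD /l /r /delta; congr EFin; field.
by rewrite !gt_eqF ?addr_gt0.
Qed.
End Windows.

Section WindowIntegrals.
Context {R : realType} (P : params R).
Hypotheses (b0 : 0 < beta P) (g0 : 0 < gamma P).
Implicit Types x y t : R.
Local Notation s := (schedule_cost P).
Local Notation leb := (@lebesgue_measure R).

Lemma indic_window x t : \1_(window P x) t = (s t < x)%R%:R :> R.
Proof.
rewrite indicE (_ : (t \in _) = (s t < x)%R)//; apply/idP/idP => tx.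
  by move: tx; rewrite inE.
by rewrite inE.
Qed.

Lemma ae_schedule_cost_neq x : {ae leb, forall t, s t <> x}.
Proof.
exists [set - (x / beta P); x / gamma P]; split.
- by apply: measurableU; exact: measurable_set1.
- apply: countable_lebesgue_measure0; apply: finite_set_countable.
  exact: finite_set2.
move=> t /= /contrapT; rewrite /schedule_cost; case: ltP => t0 stx.
  by left; rewrite -stx; field; rewrite gt_eqF.
by right; rewrite -stx; field; rewrite gt_eqF.
Qed.

Lemma measurable_scaled_window (p x : R) :
  measurable_fun setT (fun t => p * \1_(window P x) t).
Proof.
by apply: measurable_funM => //; apply: measurable_indic; exact: measurable_window.
Qed.

Lemma integral_window (p x : R) : 0 <= p ->
  (\int[leb]_t (p * \1_(window P x) t)%:E = (p * (Num.max 0 x / delta P))%:E)%E.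
Proof.
move=> p0; under eq_integral do rewrite EFinM.
rewrite ge0_integralZl_EFin//; last first.
  by apply/measurable_EFinP; apply: measurable_indic; exact: measurable_window.
rewrite integral_indic//; last exact: measurable_window.
by rewrite setIT EFinM; congr (_ * _)%E; exact: lebesgue_measure_window.
Qed.

Lemma integral_windows (p q x y : R) : 0 <= p -> 0 <= q ->
  (\int[leb]_t (p * \1_(window P x) t + q * \1_(window P y) t)%:E =
   (p * (Num.max 0 x / delta P) + q * (Num.max 0 y / delta P))%:E)%E.
Proof.
move=> p0 q0; under eq_integral do rewrite EFinD.
rewrite ge0_integralD// ?integral_window//.
- by move=> t _; rewrite lee_fin mulr_ge0// indicE ler0n.
- by apply/measurable_EFinP; exact: measurable_scaled_window.
- by move=> t _; rewrite lee_fin mulr_ge0// indicE ler0n.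
- by apply/measurable_EFinP; exact: measurable_scaled_window.
Qed.

End WindowIntegrals.

(** * Complementary slackness at a given time *)

(** Here [u] is C - s(t), [d] the rent at which SAVs outbid NVs, [x] and [y]
    are the NV and SAV flows. The toll is determined everywhere, and the flows
    wherever [u] is neither 0 nor [d], where two regimes meet. *)
Lemma complementary_slackness (R : realFieldType) (k b d mu u tau x y : R) :
  0 < k < 1 -> 0 < b -> 0 < mu -> b = (1 - k) * d ->
  0 <= x -> 0 <= y -> 0 <= tau ->
  u <= tau -> (0 < x -> tau = u) ->
  u - b <= k * tau -> (0 < y -> k * tau = u - b) ->
  (0 < tau -> x + k * y = mu) ->
  tau = Num.max 0 u + (k^-1 - 1) * Num.max 0 (u - d) /\
  (u <> 0 -> u <> d ->
    x = mu * ((0 < u)%R%:R - (d < u)%R%:R) /\ y = mu / k * (d < u)%R%:R).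
Proof.
move=> /andP[k0 k1] b0 mu0 bd x0 y0 t0 ut xt ubt yt tm.
have k1' : 0 < 1 - k by rewrite subr_gt0.
have d0 : 0 < d by rewrite -(pmulr_rgt0 _ k1') -bd.
have kn0 : k != 0 by rewrite gt_eqF.
have xz : u < tau -> x = 0.
  move=> tu; apply/eqP; rewrite eq_le x0 andbT leNgt; apply/negP => /xt; lra.
have yz : u - b < k * tau -> y = 0.
  move=> tu; apply/eqP; rewrite eq_le y0 andbT leNgt; apply/negP => /yt; lra.
case: (ltgtP u 0) => [u0|u0|u0].
- have z : tau = 0.
    apply/eqP; rewrite eq_le t0 andbT leNgt; apply/negP => tp.
    have := tm tp; rewrite xz ?yz; nra.
  have -> : Num.max 0 (u - d) = 0 by rewrite max_l//; lra.
  split; first lra.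
  move=> _ _; rewrite xz ?yz; [|nra..].
  by rewrite ltNge (ltW (lt_trans u0 d0)) /= subrr !mulr0.
- have tp : 0 < tau by lra.
  case: (ltgtP u d) => [ud|ud|ud].
  + have y_0 : y = 0.
      apply: yz; have : 0 < (1 - k) * (d - u) by rewrite mulr_gt0 ?subr_gt0.
      have : 0 <= k * (tau - u) by rewrite mulr_ge0 ?subr_ge0// ltW.
      by lra.
    have xmu : x = mu by have := tm tp; rewrite y_0; lra.
    have tu : tau = u by apply: xt; lra.
    have -> : Num.max 0 (u - d) = 0 by rewrite max_l//; lra.
    split; first lra.
    by move=> _ _; rewrite y_0 xmu subr0 mulr1 mulr0.
  + have kt : k * u < k * tau.
      have : 0 < (1 - k) * (u - d) by rewrite mulr_gt0 ?subr_gt0.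
      by lra.
    have x_0 : x = 0 by apply: xz; rewrite -(ltr_pM2l k0).
    have ymu : k * y = mu by have := tm tp; rewrite x_0; lra.
    have ktu : k * tau = u - b by apply: yt; nra.
    have -> : Num.max 0 (u - d) = u - d by rewrite max_r//; lra.
    split.
      by apply: (mulfI kn0); rewrite ktu bd; field.
    by move=> _ _; rewrite x_0 -ymu subrr mulr0 mulr1; split => //; field.
  + split=> //; rewrite ud subrr maxxx mulr0 addr0.
    have [xp|xn] := ltP 0 x; first by rewrite xt.
    have x_0 : x = 0 by lra.
    have yp : 0 < y by have := tm tp; rewrite x_0; nra.
    by have := yt yp => ktu; apply: (mulfI kn0); rewrite ktu bd ud; ring.
- rewrite u0 max_l; last lra; split; last by [].
  rewrite mulr0 addr0; apply/eqP; rewrite eq_le t0 andbT leNgt; apply/negP => tp.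
  have := tm tp; rewrite xz ?yz; nra.
Qed.

(** * Structure and optimality of first-best equilibria *)

Section Equilibrium.
Context {R : realType} (P : params R).
Implicit Types (C t c : R) (x y n_n n_a tau : R -> R).
Local Notation s := (schedule_cost P).
Local Notation N := (mass P).
Local Notation mu := (capacity P).
Local Notation k := (kappa P).
Local Notation leb := (@lebesgue_measure R).

(** The NV trip cost at zero schedule cost. *)
Definition base_cost : R := t_free P + nv_fixed P.

(** The NV bid at which NVs and SAVs bid the same amount per unit of capacity;
    SAVs win the bottleneck above it. *)
Definition switch_rent : R := B P / (1 - k).

(** The equilibrium toll, NV flow and SAV flow as functions of the rent
    C = c - [base_cost]. *)
Definition toll C t : R :=
  tent P C t + (k^-1 - 1) * tent P (C - switch_rent) t.

Definition nv_flow C t : R :=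
  mu * (\1_(window P C) t - \1_(window P (C - switch_rent)) t).

Definition sav_flow C t : R := mu / k * \1_(window P (C - switch_rent)) t.

(** Increase of the schedule cost of the marginal arrival per unit of capacity
    use: the windows serving x NVs or x / kappa SAVs reach the schedule cost
    x times this rate. *)
Definition congestion_rate : R := beta P * gamma P / (mu * (beta P + gamma P)).

Lemma nv_trip_costE t : nv_trip_cost P t = base_cost + s t.
Proof. by rewrite /nv_trip_cost /base_cost; ring. Qed.

Lemma sav_trip_costE t : sav_trip_cost P t = base_cost + B P + s t.
Proof. by rewrite /sav_trip_cost /base_cost /B; ring. Qed.

Hypothesis hP : standing P.

Lemma standing_pos : [/\ 0 < beta P, 0 < gamma P, 0 < mu, 0 < k & k < 1].
Proof. by case: hP => -[_ ? _] _ [? ? _ _] /andP[]. Qed.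

Lemma switch_rentE : B P = (1 - k) * switch_rent.
Proof.
have [_ _ _ _ k1] := standing_pos.
by rewrite /switch_rent mulrC divfK// subr_eq0 gt_eqF.
Qed.

Lemma switch_rent_gt0 : 0 < switch_rent.
Proof.
have [_ _ _ _ k1] := standing_pos; case: hP => _ _ _ _ /andP[B0 _].
by rewrite divr_gt0// subr_gt0.
Qed.

Lemma congestion_rate_gt0 : 0 < congestion_rate.
Proof. by have [? ? ? _ _] := standing_pos; rewrite divr_gt0 ?mulr_gt0 ?addr_gt0. Qed.

Lemma AE : A P = congestion_rate * (1 - theta P).
Proof.
have [b0 g0 mu0 _ _] := standing_pos.
by rewrite /A /congestion_rate; field; rewrite !gt_eqF ?addr_gt0.
Qed.

Lemma nv_trip_cost_ge0 t : 0 <= nv_trip_cost P t.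
Proof.
have [b0 g0 _ _ _] := standing_pos; case: hP => -[_ _ tf0] [Fn0 _ _ _] _ _ _.
by rewrite !addr_ge0// schedule_cost_ge0.
Qed.

Lemma sav_trip_cost_ge0 t : 0 <= sav_trip_cost P t.
Proof.
have [b0 g0 _ _ _] := standing_pos; case: hP => -[_ _ tf0] [_ w0 m0 _] [_ _ bth _] _ _.
have th0 : 0 <= theta P by rewrite ltW// (lt_trans b0).
by rewrite !addr_ge0 ?mulr_ge0 ?schedule_cost_ge0.
Qed.

Lemma measurable_nv_trip_cost : measurable_fun setT (nv_trip_cost P).
Proof.
have [b0 g0 _ _ _] := standing_pos.
rewrite (_ : nv_trip_cost P = (fun t => base_cost + s t)).
  by apply: measurable_funD => //; exact: measurable_schedule_cost.
by apply/funext => t; exact: nv_trip_costE.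
Qed.

Lemma measurable_sav_trip_cost : measurable_fun setT (sav_trip_cost P).
Proof.
have [b0 g0 _ _ _] := standing_pos.
rewrite (_ : sav_trip_cost P = (fun t => base_cost + B P + s t)).
  by apply: measurable_funD => //; exact: measurable_schedule_cost.
by apply/funext => t; exact: sav_trip_costE.
Qed.

Lemma measurable_toll C : measurable_fun setT (toll C).
Proof.
have [b0 g0 _ _ _] := standing_pos.
by apply: measurable_funD; [|apply: measurable_funM => //]; exact: measurable_tent.
Qed.

Lemma toll_ge0 C t : 0 <= toll C t.
Proof.
have [_ _ _ k0 k1] := standing_pos.
by rewrite addr_ge0 ?mulr_ge0 ?tent_ge0// subr_ge0 invf_ge1// ltW.
Qed.

Lemma integral_flows C : (\int[leb]_t (nv_flow C t + sav_flow C t)%:E =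
  (mu * (Num.max 0 C / delta P) +
   mu * (k^-1 - 1) * (Num.max 0 (C - switch_rent) / delta P))%:E)%E.
Proof.
have [b0 g0 mu0 k0 k1] := standing_pos.
rewrite -integral_windows//; last 2 first.
- exact: ltW.
- by rewrite mulr_ge0 ?subr_ge0 ?invf_ge1// ltW.
by apply: eq_integral => t _; congr EFin; rewrite /nv_flow /sav_flow; ring.
Qed.

Section GivenEquilibrium.
Variables (n_n n_a tau : R -> R) (c : R).
Hypothesis fb : first_best_equilibrium P n_n n_a tau c.
Local Notation C := (c - base_cost).

Let slackness t :
  tau t = Num.max 0 (C - s t) + (k^-1 - 1) * Num.max 0 (C - s t - switch_rent) /\
  (C - s t <> 0 -> C - s t <> switch_rent ->
    n_n t = mu * ((0 < C - s t)%R%:R - (switch_rent < C - s t)%R%:R) /\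
    n_a t = mu / k * (switch_rent < C - s t)%R%:R).
Proof.
have [b0 g0 mu0 k0 k1] := standing_pos; case: hP => _ _ _ k01 /andP[B0 _].
case: fb => -[_ n0 _ _] tau0 en ea cap.
have [en1 en2] := en t; have [ea1 ea2] := ea t; have [nn0 na0] := n0 t.
move: en1 en2 ea1 ea2; rewrite nv_trip_costE sav_trip_costE => en1 en2 ea1 ea2.
apply: (@complementary_slackness _ k (B P) switch_rent mu (C - s t) (tau t)) => //.
- exact: switch_rentE.
- by lra.
- by move=> /en2; lra.
- by lra.
- by move=> /ea2; lra.
- exact: cap.
Qed.

Lemma equilibrium_toll : tau = toll C.
Proof.
apply/funext => t; have [-> _] := slackness t.
by rewrite /toll /tent; congr (Num.max 0 _ + _ * Num.max 0 _); ring.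
Qed.

(** The flows are arbitrary at the times where the schedule cost is exactly C
    or C - [switch_rent]; these times form a null set. *)
Lemma equilibrium_flows :
  {ae leb, forall t, n_n t = nv_flow C t /\ n_a t = sav_flow C t}.
Proof.
have [b0 g0 _ _ _] := standing_pos.
have h1 := ae_schedule_cost_neq P b0 g0 C.
have h2 := ae_schedule_cost_neq P b0 g0 (C - switch_rent).
apply: (@filterS2 _ _ (ae_filter_ringOfSetsType lebesgue_measure) _ _ _ _ h1 h2).
move=> t st1 st2; have [_ sl] := slackness t.
rewrite /nv_flow /sav_flow !indic_window//.
have -> : (s t < C) = (0 < C - s t) by rewrite subr_gt0.
have -> : (s t < C - switch_rent) = (switch_rent < C - s t).
  by rewrite ltrBrDl [RHS]ltrBrDr.
apply: sl => h; [apply: st1|apply: st2]; lra.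
Qed.


Lemma equilibrium_mass :
  N = mu * (Num.max 0 C / delta P) +
      mu * (k^-1 - 1) * (Num.max 0 (C - switch_rent) / delta P).
Proof.
case: (fb) => -[[mn ma] nn0 iN _] _ _ _ _; have [_ _ mu0 k0 _] := standing_pos.
apply: EFin_inj; rewrite -integral_flows -iN.
apply: ae_eq_integral => //.
- by apply/measurable_EFinP; exact: measurable_funD.
- apply/measurable_EFinP; apply: measurable_funD.
    by apply: measurable_funM => //; apply: measurable_funB; apply: measurable_indic;
      apply: measurable_window; case: standing_pos.
  by apply: measurable_scaled_window; case: standing_pos.
apply: (@filterS _ _ (ae_filter_ringOfSetsType lebesgue_measure)
  _ _ _ equilibrium_flows).
by move=> t [nE aE] _ /=; rewrite nE aE.
Qed.

Lemma equilibrium_cost :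
  (switch_rent < C /\ C = k * N * congestion_rate + B P) \/
  (C <= switch_rent /\ C = N * congestion_rate).
Proof.
have [b0 g0 mu0 k0 k1] := standing_pos; have D0 := switch_rent_gt0.
have d0 := delta_gt0 P b0 g0; have N0 : 0 < N by case: hP => -[].
have rE : congestion_rate = delta P / mu.
  by rewrite /congestion_rate /delta; field; rewrite !gt_eqF ?addr_gt0.
have := equilibrium_mass; case: (ltP switch_rent C) => CD mE; [left|right]; split=> //.
  rewrite switch_rentE mE rE max_r; last lra.
  by rewrite max_r; [field; rewrite !gt_eqF | lra].
have C0 : 0 < C.
  rewrite ltNge; apply/negP => C0; move: N0; rewrite mE !max_l; lra.
rewrite mE rE max_r ?ltW// max_l; last lra.
by field; rewrite !gt_eqF.
Qed.

Lemma equilibrium_rent_gt0 : 0 < C.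
Proof.
have D0 := switch_rent_gt0; case: equilibrium_cost => [[? _]|[_ ->]]; first lra.
by rewrite mulr_gt0 ?congestion_rate_gt0//; case: hP => -[].
Qed.

Lemma equilibrium_cost_gt0 : 0 < c.
Proof.
have := equilibrium_rent_gt0; case: hP => -[_ _ ?] [? _ _ _] _ _ _.
rewrite /base_cost; lra.
Qed.


(** The integrand of the social cost. *)
Definition resource_cost x y t : R :=
  x t * nv_trip_cost P t + y t * sav_trip_cost P t.

Lemma integral_add_toll x y : feasible P x y ->
  (\int[leb]_t (resource_cost x y t + mu * tau t)%:E =
   \int[leb]_t (resource_cost x y t)%:E + \int[leb]_t (mu * tau t)%:E)%E.
Proof.
move=> [[mx my] xy0 _ _]; have [_ _ mu0 _ _] := standing_pos.
have mt : measurable_fun setT tau.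
  by rewrite equilibrium_toll; exact: measurable_toll.
have t0 t : 0 <= tau t by rewrite equilibrium_toll toll_ge0.
under eq_integral do rewrite EFinD.
rewrite ge0_integralD//.
- move=> t _; have [x0 y0] := xy0 t; rewrite lee_fin.
  by rewrite addr_ge0 ?mulr_ge0 ?nv_trip_cost_ge0 ?sav_trip_cost_ge0.
- apply/measurable_EFinP; apply: measurable_funD; apply: measurable_funM => //.
    exact: measurable_nv_trip_cost.
  exact: measurable_sav_trip_cost.
- by move=> t _; rewrite lee_fin mulr_ge0// ltW.
- by apply/measurable_EFinP; exact: measurable_funM.
Qed.

Lemma integral_private_cost x y : feasible P x y ->
  (\int[leb]_t (c * (x t + y t))%:E = (c * N)%:E)%E.
Proof.
move=> [[mx my] xy0 iN _]; under eq_integral do rewrite EFinM.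
rewrite ge0_integralZl_EFin//.
- by rewrite EFinM; congr (_ * _)%E.
- by move=> t _; have [x0 y0] := xy0 t; rewrite lee_fin addr_ge0.
- by apply/measurable_EFinP; exact: measurable_funD.
- by rewrite ltW ?equilibrium_cost_gt0.
Qed.

(** Integrates the pointwise bound given by nonnegativity of the reduced costs
    of [x] and [y] and of the unused capacity weighted by the toll. *)
Lemma weak_duality x y : feasible P x y ->
  ((c * N)%:E <=
   \int[leb]_t (resource_cost x y t)%:E + \int[leb]_t (mu * tau t)%:E)%E.
Proof.
move=> fxy; rewrite -integral_add_toll// -(integral_private_cost _ _ fxy).
have [[mx my] xy0 _ cap] := fxy; have [_ _ mu0 _ _] := standing_pos.
have [_ t0 en ea _] := fb; have mt := measurable_toll C.
have c0 := ltW equilibrium_cost_gt0.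
apply: ge0_le_integral => //.
- by move=> t _; have [x0 y0] := xy0 t; rewrite lee_fin mulr_ge0// addr_ge0.
- by apply/measurable_EFinP; apply: measurable_funM => //; exact: measurable_funD.
- apply/measurable_EFinP; apply: measurable_funD; last first.
    by apply: measurable_funM => //; rewrite equilibrium_toll.
  apply: measurable_funD; apply: measurable_funM => //.
    exact: measurable_nv_trip_cost.
  exact: measurable_sav_trip_cost.
move=> t _; rewrite lee_fin /resource_cost.
have [x0 y0] := xy0 t; have [en1 _] := en t; have [ea1 _] := ea t.
have : 0 <= x t * (nv_trip_cost P t + tau t - c) by rewrite mulr_ge0 ?subr_ge0.
have : 0 <= y t * (sav_trip_cost P t + k * tau t - c) by rewrite mulr_ge0 ?subr_ge0.
have : 0 <= tau t * (mu - (x t + k * y t)) by rewrite mulr_ge0 ?subr_ge0.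
lra.
Qed.

Lemma strong_duality :
  (\int[leb]_t (resource_cost n_n n_a t)%:E + \int[leb]_t (mu * tau t)%:E =
   (c * N)%:E)%E.
Proof.
case: (fb) => fn t0 en ea cap; rewrite -integral_add_toll// -(integral_private_cost _ _ fn).
have [_ n0 _ _] := fn.
apply: eq_integral => t _; congr EFin.
have [x0 y0] := n0 t; have [_ en2] := en t; have [_ ea2] := ea t.
rewrite /resource_cost.
have nE : n_n t * (nv_trip_cost P t + tau t - c) = 0.
  have [/en2 ->|] := ltP 0 (n_n t); first by rewrite subrr mulr0.
  by move=> n00; have -> : n_n t = 0; [apply/eqP; rewrite eq_le n00|rewrite mul0r].
have aE : n_a t * (sav_trip_cost P t + k * tau t - c) = 0.
  have [/ea2 ->|] := ltP 0 (n_a t); first by rewrite subrr mulr0.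
  by move=> n00; have -> : n_a t = 0; [apply/eqP; rewrite eq_le n00|rewrite mul0r].
have tE : tau t * (n_n t + k * n_a t - mu) = 0.
  have [/cap ->|] := ltP 0 (tau t); first by rewrite subrr mulr0.
  by move=> n00; have -> : tau t = 0; [apply/eqP; rewrite eq_le n00 t0|rewrite mul0r].
lra.
Qed.

(** The toll revenue is finite, so that it cancels between the two duality
    statements. *)
Lemma equilibrium_minimizes : minimizes_social_cost P n_n n_a.
Proof.
have fn : feasible P n_n n_a by case: fb.
have [_ _ mu0 _ _] := standing_pos; have [_ n0 _ _] := fn.
have sd := strong_duality.
have r0 : (0 <= \int[leb]_t (resource_cost n_n n_a t)%:E)%E.
  apply: integral_ge0 => t _; have [x0 y0] := n0 t; rewrite lee_fin.
  by rewrite addr_ge0 ?mulr_ge0 ?nv_trip_cost_ge0 ?sav_trip_cost_ge0.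
have t0 : (0 <= \int[leb]_t (mu * tau t)%:E)%E.
  apply: integral_ge0 => t _; rewrite lee_fin mulr_ge0//; first exact: ltW.
  by rewrite equilibrium_toll toll_ge0.
have tfin : (\int[leb]_t (mu * tau t)%:E)%E \is a fin_num.
  rewrite ge0_fin_numE//; apply: (@le_lt_trans _ _ (c * N)%:E); last exact: ltry.
  by rewrite -sd leeDr.
split=> // x y fxy; rewrite /social_cost; apply: leeD2r.
have wd := weak_duality _ _ fxy; move: wd; rewrite -sd.
by rewrite leeD2rE.
Qed.

Lemma integral_toll : switch_rent < C ->
  (\int[leb]_t (mu * tau t)%:E =
   ((C ^+ 2 + (k^-1 - 1) * (C - switch_rent) ^+ 2) / (2 * congestion_rate))%:E)%E.
Proof.
move=> DC; have [b0 g0 mu0 k0 k1] := standing_pos; have C0 := equilibrium_rent_gt0.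
have ki : 0 <= k^-1 - 1 by rewrite subr_ge0 invf_ge1// ltW.
have mtent z : measurable_fun setT (EFin \o tent P z).
  by apply/measurable_EFinP; exact: measurable_tent.
rewrite equilibrium_toll.
under eq_integral do rewrite EFinM.
rewrite ge0_integralZl_EFin//; last 3 first.
- by move=> t _; rewrite lee_fin toll_ge0.
- by apply/measurable_EFinP; exact: measurable_toll.
- exact: ltW.
under eq_integral do rewrite EFinD EFinM.
rewrite ge0_integralD//; last 4 first.
- by move=> t _; rewrite lee_fin tent_ge0.
- exact: mtent.
- by move=> t _; rewrite -EFinM lee_fin mulr_ge0 ?tent_ge0.
- by apply: measurable_funeM; exact: mtent.
rewrite ge0_integralZl_EFin//; last 2 first.
- by move=> t _; rewrite lee_fin tent_ge0.
- exact: mtent.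
rewrite !integral_tent//; last by rewrite subr_gt0.
transitivity ((mu * (C ^+ 2 / (2 * delta P) +
    (k^-1 - 1) * ((C - switch_rent) ^+ 2 / (2 * delta P))))%:E); first by [].
rewrite /congestion_rate /delta; congr EFin.
by field; rewrite !gt_eqF ?addr_gt0.
Qed.

(** The NV integral is the difference between the integrals over the windows
    of C and of C - [switch_rent]. *)
Lemma both_modes_usedP : switch_rent < C -> both_modes_used n_n n_a.
Proof.
move=> DC; have [b0 g0 mu0 k0 k1] := standing_pos; have D0 := switch_rent_gt0.
have d0 := delta_gt0 P b0 g0.
have [[mn ma] nn0 _ _] : feasible P n_n n_a by case: fb.
have aF := ae_filter_ringOfSetsType (@lebesgue_measure R).
have mw (p z : R) : measurable_fun setT (fun t => (p * \1_(window P z) t)%:E).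
  by apply/measurable_EFinP; exact: measurable_scaled_window.
have mk0 : 0 < mu / k by rewrite divr_gt0.
have CD0 : Num.max 0 (C - switch_rent) = C - switch_rent by rewrite max_r//; lra.
have C0 : Num.max 0 C = C by rewrite max_r//; lra.
split.
  have : (\int[leb]_t (n_n t)%:E + (mu * ((C - switch_rent) / delta P))%:E =
      (mu * (C / delta P))%:E)%E.
    rewrite -[in LHS]CD0 -integral_window//; last exact: ltW.
    rewrite -ge0_integralD//; last 4 first.
    - by move=> t _; have [] := nn0 t; rewrite lee_fin.
    - exact/measurable_EFinP.
    - by move=> t _; rewrite lee_fin mulr_ge0 ?indicE ?ler0n// ltW.
    - exact: mw.
    rewrite -[in RHS]C0 -integral_window//; last exact: ltW.
    apply: ae_eq_integral => //.
      by apply: emeasurable_funD; [exact/measurable_EFinP | exact: mw].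
      exact: mw.
    apply: (@filterS _ _ aF _ _ _ equilibrium_flows) => t [nE _] _ /=.
    by rewrite nE -EFinD /nv_flow; congr EFin; ring.
  move=> nE; rewrite lt0e; apply/andP; split; last first.
    by apply: integral_ge0 => t _; have [] := nn0 t; rewrite lee_fin.
  apply/eqP => n0; move: nE; rewrite n0 add0e => -[] /(mulfI (lt0r_neq0 mu0)).
  move=> /(mulIf (lt0r_neq0 _)); rewrite invr_gt0 => /(_ d0); lra.
have -> : (\int[leb]_t (n_a t)%:E = (mu / k * ((C - switch_rent) / delta P))%:E)%E.
  rewrite -[in RHS]CD0 -integral_window//; last exact: ltW.
  apply: ae_eq_integral => //; [exact/measurable_EFinP | exact: mw |].
  by apply: (@filterS _ _ aF _ _ _ equilibrium_flows) => t [_ aE] _ /=; rewrite aE.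
by rewrite lte_fin mulr_gt0// divr_gt0// subr_gt0.
Qed.

End GivenEquilibrium.

End Equilibrium.

(** * Existence *)

(** The converse of [complementary_slackness]: the explicit toll satisfies the
    equilibrium conditions. *)
Lemma toll_slackness (R : realFieldType) (k b d u : R) :
  0 < k < 1 -> b = (1 - k) * d -> 0 < d ->
  let tau := Num.max 0 u + (k^-1 - 1) * Num.max 0 (u - d) in
  [/\ u <= tau, 0 < u <= d -> tau = u, u - b <= k * tau,
      d < u -> k * tau = u - b & 0 < tau -> 0 < u].
Proof.
move=> /andP[k0 k1] bd d0 /=; have kn0 : k != 0 by rewrite gt_eqF.
have [ud|ud] := leP u d.
  have -> : Num.max 0 (u - d) = 0 by rewrite max_l// subr_le0.
  rewrite mulr0 addr0; have [u0|u0] := leP u 0.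
    have kd : 0 < (1 - k) * d by rewrite mulr_gt0 ?subr_gt0.
    split; lra.
  split; try lra.
  have : 0 <= (1 - k) * (d - u) by rewrite mulr_ge0 ?subr_ge0// ltW.
  by lra.
have u0 : 0 < u by lra.
have -> : Num.max 0 u = u by rewrite max_r// ltW.
have -> : Num.max 0 (u - d) = u - d by rewrite max_r// subr_ge0 ltW.
have kt : k * (u + (k^-1 - 1) * (u - d)) = u - b by rewrite bd; field.
split; rewrite ?kt//; try lra.
rewrite lerDl mulr_ge0 ?subr_ge0 ?invf_ge1 ?ltW//.
Qed.

Section Existence.
Context {R : realType} (P : params R).
Hypothesis hP : standing P.
Local Notation s := (schedule_cost P).
Local Notation N := (mass P).
Local Notation mu := (capacity P).
Local Notation k := (kappa P).

(** Any rent [C] that serves the total mass [N] yields an equilibrium. *)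
Lemma flows_equilibrium (C : R) :
  N = mu * (Num.max 0 C / delta P) +
      mu * (k^-1 - 1) * (Num.max 0 (C - switch_rent P) / delta P) ->
  first_best_equilibrium P (nv_flow P C) (sav_flow P C) (toll P C)
    (C + base_cost P).
Proof.
move=> NE; have [b0 g0 mu0 k0 k1] := standing_pos P hP.
have k01 : 0 < k < 1 by rewrite k0.
have d0 := switch_rent_gt0 P hP; have bd := switch_rentE P hP.
have flowE t :
  nv_flow P C t = mu * ((0 < C - s t)%R%:R - (switch_rent P < C - s t)%R%:R)
    /\ sav_flow P C t = mu / k * (switch_rent P < C - s t)%R%:R.
  rewrite /nv_flow /sav_flow !indic_window// subr_gt0.
  by rewrite (_ : (s t < C - _) = (switch_rent P < C - s t))// ltrBrDl [RHS]ltrBrDr.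
have tollE t : toll P C t = Num.max 0 (C - s t) +
    (k^-1 - 1) * Num.max 0 (C - s t - switch_rent P).
  by rewrite /toll /tent; congr (Num.max 0 _ + _ * Num.max 0 _); ring.
have mk0 : 0 < mu / k by rewrite divr_gt0.
have capE : k * (mu / k) = mu by field; rewrite gt_eqF.
split.
- split.
  + split; last exact: measurable_scaled_window.
    by apply: measurable_funM => //; apply: measurable_funB;
      apply: measurable_indic; exact: measurable_window.
  + move=> t; have [-> ->] := flowE t; split; last by rewrite mulr_ge0 ?ler0n// ltW.
    rewrite mulr_ge0 ?(ltW mu0)//.
    by case: ltP => u0; case: ltP => ud /=; lra.
  + by rewrite integral_flows// -NE.
  + move=> t; have [-> ->] := flowE t; rewrite mulrA capE.
    by case: ltP => u0; case: ltP => ud /=; lra.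
- by move=> t; exact: toll_ge0.
- move=> t; have [-> _] := flowE t; rewrite nv_trip_costE.
  have := @toll_slackness _ k _ _ (C - s t) k01 bd d0; rewrite -tollE => -[t1 t2 _ _ _].
  split; first lra.
  case: (ltP 0 (C - s t)) => u0; case: (ltP (switch_rent P) (C - s t)) => ud /=;
    rewrite ?subrr ?mulr0 ?ltxx ?subr0 => //.
    by move=> _; rewrite t2 ?u0//; lra.
  by rewrite sub0r mulrN1; lra.
- move=> t; have [_ ->] := flowE t; rewrite sav_trip_costE.
  have := @toll_slackness _ k _ _ (C - s t) k01 bd d0; rewrite -tollE => -[_ _ t3 t4 _].
  split; first lra.
  case: (ltP (switch_rent P) (C - s t)) => ud /=; rewrite ?mulr0 ?ltxx// => _.
  by rewrite t4//; lra.
- move=> t; have [-> ->] := flowE t.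
  have := @toll_slackness _ k _ _ (C - s t) k01 bd d0; rewrite -tollE => -[_ _ _ _ t5].
  move=> /t5 ->; rewrite mulrA capE; case: ltP => ud /=; lra.
Qed.

Lemma first_best_equilibrium_exists :
  exists (n_n n_a tau : R -> R) (c : R), first_best_equilibrium P n_n n_a tau c.
Proof.
have [b0 g0 mu0 k0 k1] := standing_pos P hP.
have d0 := switch_rent_gt0 P hP; have bd := switch_rentE P hP.
have dl0 := delta_gt0 P b0 g0; have N0 : 0 < N by case: hP => -[].
pose K := congestion_rate P; have K0 : 0 < K := congestion_rate_gt0 P hP.
have rE : delta P = K * mu.
  by rewrite /K /congestion_rate /delta; field; rewrite !gt_eqF ?addr_gt0.
pose C := if switch_rent P < N * K then k * N * K + B P else N * K.
exists (nv_flow P C), (sav_flow P C), (toll P C), (C + base_cost P).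
apply: flows_equilibrium; rewrite /C rE; case: ltP => NK.
  have C1 : switch_rent P < k * N * K + B P.
    have : 0 < k * (N * K - switch_rent P) by rewrite mulr_gt0 ?subr_gt0.
    by rewrite bd; lra.
  have -> : Num.max 0 (k * N * K + B P) = k * N * K + B P by rewrite max_r//; lra.
  have -> : Num.max 0 (k * N * K + B P - switch_rent P) =
      k * N * K + B P - switch_rent P by rewrite max_r//; lra.
  by rewrite bd; field; rewrite !gt_eqF.
have NK0 : 0 < N * K by rewrite mulr_gt0.
have -> : Num.max 0 (N * K) = N * K by rewrite max_r// ltW.
have -> : Num.max 0 (N * K - switch_rent P) = 0 by rewrite max_l//; lra.
by field; rewrite !gt_eqF.
Qed.

End Existence.

(** * Comparison with the toll-free equilibria *)

(** With [d] the switching rent and [a] the SAV mass, the left-hand side is the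
    first-best social cost and the right-hand side the toll-free one, both
    without the fixed cost of the provider. *)
Lemma splitting_cost_lt (R : realFieldType) (K N k th d a base C : R) :
  0 < K -> 0 < N -> 0 < k < 1 -> 0 < th -> 0 <= a -> 0 <= N - a ->
  C = k * N * K + (1 - k) * d ->
  N * (C + base) - (C ^+ 2 + (k^-1 - 1) * (C - d) ^+ 2) / (2 * K) <
  N * (base + K * (N - (1 - k) * a)) - a * (K * (1 - th) * (N - a) - (1 - k) * d).
Proof.
move=> K0 N0 /andP[k0 k1] th0 a0 n0 CE; rewrite -subr_gt0.
(* the gap is avoidable queueing plus the loss from a suboptimal split *)
have -> : N * (base + K * (N - (1 - k) * a)) -
    a * (K * (1 - th) * (N - a) - (1 - k) * d) -
    (N * (C + base) - (C ^+ 2 + (k^-1 - 1) * (C - d) ^+ 2) / (2 * K)) =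
  K / 2 * ((N - a) ^+ 2 + k * a ^+ 2) + K * th * ((N - a) * a) +
  K * (1 - k) / 2 * (N - a - d / K) ^+ 2.
  by rewrite CE; field; rewrite !gt_eqF.
have an : 0 <= (N - a) * a by rewrite mulr_ge0.
have sq : 0 < (N - a) ^+ 2 + k * a ^+ 2.
  have [->|a1] := eqVneq a 0; first by rewrite subr0 expr0n mulr0 addr0 exprn_gt0.
  by rewrite ltr_wpDl ?sqr_ge0// mulr_gt0// lt0r sqr_ge0 expf_neq0.
have h1 : 0 < K / 2 * ((N - a) ^+ 2 + k * a ^+ 2) by rewrite mulr_gt0// divr_gt0.
have h2 : 0 <= K * th * ((N - a) * a) by rewrite mulr_ge0// mulr_ge0// ltW.
have h3 : 0 <= K * (1 - k) / 2 * (N - a - d / K) ^+ 2.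
  by rewrite mulr_ge0 ?sqr_ge0// divr_ge0// mulr_ge0 ?subr_ge0 ?ltW.
by rewrite ltr_wpDr// ltr_wpDr.
Qed.

Section Comparison.
Context {R : realType} (P : params R).
Hypothesis hP : standing P.
Local Notation N := (mass P).
Local Notation mu := (capacity P).
Local Notation k := (kappa P).
Local Notation K := (congestion_rate P).
Local Notation D := (switch_rent P).

Lemma nv_costE e : nv_cost P e = base_cost P + K * (N - (1 - k) * savs e).
Proof. by rewrite /nv_cost /nvs /congestion_rate /base_cost; ring. Qed.

Lemma nv_cost_le e e' : savs e' <= savs e -> nv_cost P e <= nv_cost P e'.
Proof.
have [_ _ _ _ k1] := standing_pos P hP; have K0 := congestion_rate_gt0 P hP.
move=> ee; rewrite !nv_costE lerD2l ler_pM2l// lerD2l lerN2 ler_pM2l//.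
by rewrite subr_gt0.
Qed.

Lemma nv_cost_lt e e' : savs e' < savs e -> nv_cost P e < nv_cost P e'.
Proof.
have [_ _ _ _ k1] := standing_pos P hP; have K0 := congestion_rate_gt0 P hP.
move=> ee; rewrite !nv_costE ltrD2l ltr_pM2l// ltrD2l ltrN2 ltr_pM2l//.
by rewrite subr_gt0.
Qed.

(** The fare is a transfer and cancels; the subtracted term is the cost
    advantage of SAVs over NVs at marginal cost pricing. *)
Lemma tollfree_social_costE e : tollfree_social_cost P e =
  N * nv_cost P e - savs e * (K * (1 - theta P) * (N - savs e) - B P) + sav_fixed P.
Proof.
have -> : K * (1 - theta P) * (N - savs e) - B P =
    nv_cost P e - sav_cost P e + (fare e - sav_marginal P).
  by rewrite (cost_gap _ hP) -(AE P hP) /nvs; ring.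
by rewrite /tollfree_social_cost /profit /nvs; ring.
Qed.

Lemma c_MCE : c_MC P = base_cost P + k * N * K + eta_ratio P * B P.
Proof.
have [_ _ _ _ k1] := standing_pos P hP; have K0 := congestion_rate_gt0 P hP.
have th1 : 0 < 1 - theta P by rewrite subr_gt0; case: hP => _ _ [].
rewrite /c_MC nv_costE /= (AE P hP) /eta_ratio; field.
by rewrite !gt_eqF.
Qed.

Lemma B_lt : B P < K * (1 - theta P) * N.
Proof. by rewrite -(AE P hP); case: hP => _ _ _ _ /andP[]. Qed.

Lemma sqrt_discriminant_lt : 0 <= discriminant P ->
  Num.sqrt (discriminant P) < A P * N - B P.
Proof.
move=> d0; have A0 := A_gt0 hP; case: (hP) => _ [_ _ _ Fa0] _ _ /andP[_ BAN].
have x0 : 0 < A P * N - B P by rewrite subr_gt0.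
rewrite -(@ltr_pXn2r _ 2) ?nnegrE ?sqrtr_ge0 ?(ltW x0)// sqr_sqrtr// /discriminant.
by rewrite ltrBlDr ltrDl mulr_gt0// mulr_gt0.
Qed.

Lemma savs_order : 0 <= discriminant P ->
  [/\ savs (AC2 P) < savs (MC P), savs (monopoly P) <= savs (AC2 P)
    & savs (AC0 P) < savs (monopoly P)].
Proof.
move=> d0; have A0 := A_gt0 hP; have sx := sqrt_discriminant_lt d0.
have s0 := sqrtr_ge0 (discriminant P).
have A2 : 0 < 2 * A P by apply: mulr_gt0.
rewrite /=; split.
- rewrite (_ : (A P * N - B P) / A P = 2 * (A P * N - B P) / (2 * A P)); last first.
    by field; rewrite gt_eqF.
  by rewrite ltr_pM2r ?invr_gt0//; lra.
- by rewrite ler_pM2r ?invr_gt0//; lra.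
- by rewrite divr_gt0//; lra.
Qed.

Lemma tollfree_cost_order : 0 <= discriminant P ->
  [/\ c_MC P < c_AC2 P, c_AC2 P <= c_monopoly P & c_monopoly P < c_AC0 P].
Proof.
by move=> /savs_order[? ? ?]; split; [exact: nv_cost_lt | exact: nv_cost_le |
  exact: nv_cost_lt].
Qed.

Lemma c_MC_lt_AC0 : c_MC P < c_AC0 P.
Proof.
apply: nv_cost_lt => /=; rewrite divr_gt0 ?(A_gt0 hP)// subr_gt0.
by case: hP => _ _ _ _ /andP[].
Qed.

Section GivenFirstBest.
Variables (n_n n_a tau : R -> R) (c : R).
Hypothesis fb : first_best_equilibrium P n_n n_a tau c.
Local Notation C := (c - base_cost P).

Lemma first_best_social_cost : D < C ->
  social_cost P n_n n_a =
  (N * c - (C ^+ 2 + (k^-1 - 1) * (C - D) ^+ 2) / (2 * K) + sav_fixed P)%:E.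
Proof.
move=> DC; have sd := strong_duality P hP _ _ _ _ fb.
rewrite (integral_toll P hP _ _ _ _ fb DC) in sd.
rewrite /social_cost EFinD; congr (_ + _)%E; apply/eqP.
by rewrite (mulrC N) EFinB eq_sym sube_eq ?fin_num_adde_defl//; apply/eqP; rewrite sd.
Qed.

(** If C were at most [switch_rent], then C = N K, so that
    (1 - kappa) N K <= B < (1 - theta) N K, against eta >= 1. *)
Lemma first_best_uses_both : 1 <= eta_ratio P -> D < C.
Proof.
have [_ _ _ _ k1] := standing_pos P hP; have K0 := congestion_rate_gt0 P hP.
have th1 : 0 < 1 - theta P by rewrite subr_gt0; case: hP => _ _ [].
have N0 : 0 < N by case: hP => -[].
rewrite /eta_ratio ler_pdivlMr// mul1r => eta1.
have [[]//|[CD CE]] := equilibrium_cost P hP _ _ _ _ fb; exfalso.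
have h1 : 0 <= (1 - k) * (D - N * K) by rewrite mulr_ge0 ?subr_ge0 -?CE// ltW.
have h2 : 0 <= (1 - k - (1 - theta P)) * (N * K).
  by rewrite mulr_ge0 ?subr_ge0// mulr_ge0// ltW.
have := B_lt; rewrite (switch_rentE P hP); lra.
Qed.

Lemma first_best_cost_le_MC : 1 <= eta_ratio P -> c <= c_MC P.
Proof.
move=> eta1; have DC := first_best_uses_both eta1.
have B0 : 0 < B P by case: hP => _ _ _ _ /andP[].
case: (equilibrium_cost P hP _ _ _ _ fb) => [[_ CE]|[]]; last lra.
rewrite c_MCE; have : 0 <= (eta_ratio P - 1) * B P.
  by rewrite mulr_ge0 ?(ltW B0)// subr_ge0.
lra.
Qed.

Lemma MC_lt_first_best_cost : eta_ratio P < 1 -> c_MC P < c.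
Proof.
move=> eta1; have B0 : 0 < B P by case: hP => _ _ _ _ /andP[].
have [_ _ _ _ k1] := standing_pos P hP.
have th1 : 0 < 1 - theta P by rewrite subr_gt0; case: hP => _ _ [].
rewrite c_MCE; case: (equilibrium_cost P hP _ _ _ _ fb) => [] [_ CE].
  have : 0 < (1 - eta_ratio P) * B P by rewrite mulr_gt0// subr_gt0.
  lra.
have : eta_ratio P * B P < eta_ratio P * (K * (1 - theta P) * N).
  by rewrite ltr_pM2l ?B_lt// divr_gt0// subr_gt0.
have -> : eta_ratio P * (K * (1 - theta P) * N) = (1 - k) * N * K.
  by rewrite /eta_ratio; field; rewrite gt_eqF.
lra.
Qed.

Lemma first_best_pareto e : 1 <= eta_ratio P ->
  tollfree_equilibrium P e (nv_cost P e) -> c_MC P <= nv_cost P e ->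
  pareto_improves P n_n n_a c e.
Proof.
move=> eta1 [n0 a0 _ ea] cMC; have DC := first_best_uses_both eta1.
have cle := le_trans (first_best_cost_le_MC eta1) cMC.
split=> // [|/ea ->//].
rewrite first_best_social_cost// lte_fin tollfree_social_costE ltrD2r nv_costE.
have [b0 _ _ k0 k1] := standing_pos P hP; have k01 : 0 < k < 1 by rewrite k0.
have N0 : 0 < N by case: hP => -[].
have th0 : 0 < theta P by case: hP => _ _ [_ _ bt _] _ _; exact: lt_trans bt.
case: (equilibrium_cost P hP _ _ _ _ fb) => [[_ CE]|[]]; last lra.
rewrite (switch_rentE P hP) in CE *.
have := @splitting_cost_lt _ K N k (theta P) D (savs e) (base_cost P) C
  (congestion_rate_gt0 P hP) N0 k01 th0 a0 n0 CE.
by rewrite subrK.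
Qed.

End GivenFirstBest.

End Comparison.

Theorem proposition5 (R : realType) (P : params R) (hP : standing P) :
  (exists (n_n n_a tau : R -> R) (c : R),
     first_best_equilibrium P n_n n_a tau c) /\
  (1 <= eta_ratio P ->
   forall (n_n n_a tau : R -> R) (c_FB : R),
     first_best_equilibrium P n_n n_a tau c_FB ->
     [/\ both_modes_used n_n n_a,
         minimizes_social_cost P n_n n_a,
         0 <= discriminant P ->
           [/\ c_FB <= c_MC P, c_MC P < c_AC2 P,
               c_AC2 P <= c_monopoly P & c_monopoly P < c_AC0 P],
         pareto_improves P n_n n_a c_FB (MC P) /\
         pareto_improves P n_n n_a c_FB (AC0 P)
       & 0 <= discriminant P ->
         pareto_improves P n_n n_a c_FB (AC2 P) /\
         pareto_improves P n_n n_a c_FB (monopoly P)]) /\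
  (eta_ratio P < 1 ->
   forall (n_n n_a tau : R -> R) (c_FB : R),
     first_best_equilibrium P n_n n_a tau c_FB ->
     minimizes_social_cost P n_n n_a /\ c_MC P < c_FB).
Proof.
split; first exact: first_best_equilibrium_exists.
split=> eta1 n_n n_a tau c fb; last first.
  split; first exact: equilibrium_minimizes fb.
  exact: MC_lt_first_best_cost fb eta1.
have pareto e := @first_best_pareto _ P hP _ _ _ _ fb e eta1.
split.
- have DC := first_best_uses_both P hP _ _ _ _ fb eta1.
  exact: (both_modes_usedP P hP _ _ _ _ fb DC).
- exact: equilibrium_minimizes fb.
- move=> d0; have [? ? ?] := tollfree_cost_order P hP d0.
  by split=> //; exact: first_best_cost_le_MC fb eta1.
- split; apply: pareto; first by have [] := tollfree_MC hP.
  + exact: lexx.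
  + by have [] := tollfree_AC0 hP.
  + exact/ltW/c_MC_lt_AC0.
- move=> d0; have [c1 c2 c3] := tollfree_cost_order P hP d0.
  split; apply: pareto.
  + by have [] := tollfree_AC2 hP d0.
  + exact: ltW.
  + by have [] := tollfree_monopoly hP.
  + exact/ltW/(lt_le_trans c1).
Qed.
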